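(* Let $\mathbb F$ be a field, let $M, M'$ be $p\times q$ matrices over $\mathbb F$ and let $\vec b,\vec b'\in\mathbb F^p$. Suppose that the linear systems $M\vec x=\vec b$ and $M'\vec x=\vec b'$ (in the same unknowns) are both consistent, i.e. each has at least one solution, and that they are solution equivalent, i.e. $\{\vec x\in\mathbb F^q: M\vec x=\vec b\}=\{\vec x\in\mathbb F^q: M'\vec x=\vec b'\}$. Then the two systems are row equivalent, i.e. the augmented matrices $(M\mid\vec b)$ and $(M'\mid\vec b')$ are row equivalent.
   Context: Row operations on a matrix are: scaling a row by a nonzero scalar, interchanging two rows, and subtracting a scalar multiple of one row from another row. Two matrices of the same size are row equivalent if one is obtained from the other by a finite sequence of row operations. Row operations on a linear system $M\vec x=\vec b$ are row operations on its augmented matrix $(M\mid\vec b)$. *)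

(* Defs.v *)
From HB Require Import structures.
From Stdlib Require Import Relations.
From mathcomp Require Import all_boot all_order all_algebra.

Set Implicit Arguments.
Unset Strict Implicit.
Unset Printing Implicit Defensive.

Import GRing.Theory.
Local Open Scope ring_scope.

Section RowOperations.
Variables (F : fieldType) (m n : nat).

Definition scale_row (k : 'I_m) (c : F) (A : 'M[F]_(m, n)) : 'M[F]_(m, n) :=
  \matrix_(i, j) (if i == k then c * A k j else A i j).

Definition subtract_row (k l : 'I_m) (c : F) (A : 'M[F]_(m, n)) :
    'M[F]_(m, n) :=
  \matrix_(i, j) (if i == k then A k j - c * A l j else A i j).

Inductive row_op (A : 'M[F]_(m, n)) : 'M[F]_(m, n) -> Prop :=
| RowScale (k : 'I_m) (c : F) : c != 0 -> row_op A (scale_row k c A)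
| RowSwap (k l : 'I_m) : k != l -> row_op A (xrow k l A)
| RowSubtract (k l : 'I_m) (c : F) :
    k != l -> row_op A (subtract_row k l c A).

(* The empty sequence of row operations is allowed. *)
Definition row_equivalent (A B : 'M[F]_(m, n)) : Prop :=
  clos_refl_trans _ row_op A B.

End RowOperations.

Section LinearSystems.
Variables (F : fieldType) (p q : nat).

Definition is_solution (M : 'M[F]_(p, q)) (b : 'cV[F]_p) (x : 'cV[F]_q) :
    Prop :=
  M *m x = b.

Definition consistent (M : 'M[F]_(p, q)) (b : 'cV[F]_p) : Prop :=
  exists x : 'cV[F]_q, is_solution M b x.

Definition solution_equivalent (M : 'M[F]_(p, q)) (b : 'cV[F]_p)
    (M' : 'M[F]_(p, q)) (b' : 'cV[F]_p) : Prop :=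
  forall x : 'cV[F]_q, is_solution M b x <-> is_solution M' b' x.

Definition augmented (M : 'M[F]_(p, q)) (b : 'cV[F]_p) : 'M[F]_(p, q + 1) :=
  row_mx M b.

End LinearSystems.

(* Main.v *)
(** Translating by a common solution, M and M' have the same kernel, hence the
    same row space; since b and b' are the images of that solution, the
    augmented matrices also have the same row space, so they differ by left
    multiplication by an invertible matrix.  Row operations commute with right
    multiplication, so it remains to reduce an invertible matrix to the
    identity, which is Gauss-Jordan elimination. *)
Require Import Defs.
From HB Require Import structures.
From Stdlib Require Import Relations.
From mathcomp Require Import all_boot all_order perm all_algebra.

Set Implicit Arguments.
Unset Strict Implicit.
Unset Printing Implicit Defensive.

Import GRing.Theory.
Local Open Scope ring_scope.

Lemma scale_rowK (F : fieldType) (m n : nat) (k : 'I_m) (c : F)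
    (A : 'M[F]_(m, n)) :
  c != 0 -> scale_row k c^-1 (scale_row k c A) = A.
Proof.
move=> c_neq0; apply/matrixP => i j; rewrite !mxE eqxx.
by case: eqP => // ->; rewrite mulKf.
Qed.

Lemma subtract_rowK (F : fieldType) (m n : nat) (k l : 'I_m) (c : F)
    (A : 'M[F]_(m, n)) :
  k != l -> subtract_row k l (- c) (subtract_row k l c A) = A.
Proof.
move=> neq_kl; apply/matrixP => i j.
rewrite !mxE eqxx (eq_sym l) (negPf neq_kl).
by case: eqP => // ->; rewrite mulNr opprK subrK.
Qed.

Lemma xrowK (F : fieldType) (m n : nat) (k l : 'I_m) (A : 'M[F]_(m, n)) :
  xrow k l (xrow k l A) = A.
Proof. by apply/matrixP => i j; rewrite !mxE tpermK. Qed.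

Lemma row_op_sym (F : fieldType) (m n : nat) (A B : 'M[F]_(m, n)) :
  row_op A B -> row_op B A.
Proof.
case=> [k c c_neq0|k l neq_kl|k l c neq_kl].
- by rewrite -{2}(scale_rowK k A c_neq0); apply: RowScale; rewrite invr_eq0.
- by rewrite -{2}(xrowK k l A); apply: RowSwap.
- by rewrite -{2}(subtract_rowK c A neq_kl); apply: RowSubtract.
Qed.

Lemma row_equivalent_sym (F : fieldType) (m n : nat) (A B : 'M[F]_(m, n)) :
  row_equivalent A B -> row_equivalent B A.
Proof.
elim=> [{}A {}B /row_op_sym|{}A|{}A C {}B _ BA _ CB].
- exact: rt_step.
- exact: rt_refl.
- exact: rt_trans CB BA.
Qed.

Lemma row_op_mulmxr (F : fieldType) (m n r : nat) (A B : 'M[F]_(m, n))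
    (C : 'M[F]_(n, r)) :
  row_op A B -> row_op (A *m C) (B *m C).
Proof.
case=> [k c c_neq0|k l neq_kl|k l c neq_kl].
- have -> : scale_row k c A *m C = scale_row k c (A *m C).
    apply/matrixP => i j; rewrite !mxE; case: eqP => [->|/eqP ik].
      by rewrite mulr_sumr; apply: eq_bigr => t _; rewrite mxE eqxx mulrA.
    by apply: eq_bigr => t _; rewrite mxE (negPf ik).
  exact: RowScale.
- have -> : xrow k l A *m C = xrow k l (A *m C).
    by apply/matrixP => i j; rewrite !mxE; apply: eq_bigr => t _; rewrite mxE.
  exact: RowSwap.
- have -> : subtract_row k l c A *m C = subtract_row k l c (A *m C).
    apply/matrixP => i j; rewrite !mxE; case: eqP => [->|/eqP ik].
      rewrite mulr_sumr -sumrB; apply: eq_bigr => t _.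
      by rewrite mxE eqxx mulrBl mulrA.
    by apply: eq_bigr => t _; rewrite mxE (negPf ik).
  exact: RowSubtract.
Qed.

Lemma row_equivalent_mulmxr (F : fieldType) (m n r : nat)
    (A B : 'M[F]_(m, n)) (C : 'M[F]_(n, r)) :
  row_equivalent A B -> row_equivalent (A *m C) (B *m C).
Proof.
elim=> [{}A {}B /(row_op_mulmxr C)|{}A|{}A D {}B _ AD _ DB].
- exact: rt_step.
- exact: rt_refl.
- exact: rt_trans AD DB.
Qed.

Lemma row_equivalent0 (F : fieldType) (m n : nat) (A B : 'M[F]_(m, n)) :
  row_equivalent A B -> A = 0 -> B = 0.
Proof.
elim=> [{}A _ [k c _|k l _|k l c _] ->|//|{}A C {}B _ AC _ CB /AC/CB //];
  by apply/matrixP => i j; rewrite !mxE ?mulr0 ?subr0 ?if_same.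
Qed.

(** Row operations are reversible and fix the zero matrix. This carries injectivity of the original
    matrix through the elimination. *)
Lemma row_equivalent_ker (F : fieldType) (m n r : nat) (A B : 'M[F]_(m, n))
    (C : 'M[F]_(n, r)) :
  row_equivalent A B -> B *m C = 0 -> A *m C = 0.
Proof.
by move=> /row_equivalent_sym/(row_equivalent_mulmxr C); apply: row_equivalent0.
Qed.

(** Elimination in column [l] with pivot row [k], meant for [A k l = 1]. The list [s] lets an
    induction treat one row at a time. *)
Definition clear_rows (F : fieldType) (m n : nat) (k : 'I_m) (l : 'I_n)
    (s : seq 'I_m) (A : 'M[F]_(m, n)) : 'M[F]_(m, n) :=
  \matrix_(i, j)
    (if (i \in s) && (i != k) then A i j - A i l * A k j else A i j).

Lemma row_equivalent_clear_rows (F : fieldType) (m n : nat) (k : 'I_m)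
    (l : 'I_n) (s : seq 'I_m) (A : 'M[F]_(m, n)) :
  row_equivalent A (clear_rows k l s A).
Proof.
elim: s => [|i s IHs].
  suff -> : clear_rows k l [::] A = A by apply: rt_refl.
  by apply/matrixP => i j; rewrite mxE.
have [done|] := boolP ((i \in s) || (i == k)).
  suff -> : clear_rows k l (i :: s) A = clear_rows k l s A by [].
  apply/matrixP => i' j; rewrite !mxE inE.
  by case: (i' =P i) => // ->; case/orP: done => ->; rewrite ?andbF.
rewrite negb_or => /andP[i_s i_k].
apply: rt_trans IHs _; apply: rt_step.
(* Row [i] is not yet cleared and row [k] is never changed, so both still hold their entries from
   [A]. *)
suff -> : clear_rows k l (i :: s) A
    = subtract_row i k (A i l) (clear_rows k l s A) by apply: RowSubtract.
apply/matrixP => i' j; rewrite !mxE inE eqxx andbF (negPf i_s).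
by case: (i' =P i) => // ->; rewrite i_k.
Qed.

Lemma pivot_exists (F : fieldType) (n : nat) (A : 'M[F]_n) (k : 'I_n) :
    (forall v : 'cV_n, A *m v = 0 -> v = 0) ->
    (forall i j : 'I_n, (j < k)%N -> A i j = (i == j)%:R) ->
  exists2 i : 'I_n, (k <= i)%N & A i k != 0.
Proof.
move=> injA colA.
case: (pickP (fun i : 'I_n => (k <= i)%N && (A i k != 0))) => [i /andP[] | no].
  by exists i.
(* Otherwise column k is a combination of the preceding unit columns. *)
pose v : 'cV[F]_n :=
  \col_j (if (j < k)%N then - A j k else (j == k)%:R).
have /injA/matrixP/(_ k 0) : A *m v = 0.
  (* The term at [k] contributes [A i k]. For [i < k] the term at [i] cancels it; for [k <= i] it is
     zero by assumption and all other terms vanish. *)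
  apply/matrixP => i z; rewrite !mxE (bigD1 k) //= mxE ltnn eqxx mulr1.
  have [ik|ki] := ltnP i k.
    rewrite (bigD1 i) ?big1 /=; first last.
    - by rewrite neq_ltn ik.
    - move=> j /andP[jk ji]; rewrite mxE; case: ifP => jk'.
        by rewrite colA // eq_sym (negPf ji) mul0r.
      by rewrite (negPf jk) mulr0.
    by rewrite mxE ik (colA i i) // eqxx mul1r addr0 subrr.
  have := no i; rewrite ki /= => /negbFE/eqP ->.
  rewrite add0r big1 // => j jk; rewrite mxE; case: ifP => jk'.
    rewrite colA //; case: eqP => [ij|_]; last by rewrite mul0r.
    by move: jk'; rewrite -ij ltnNge ki.
  by rewrite (negPf jk) mulr0.
by rewrite !mxE ltnn eqxx => /eqP; rewrite oner_eq0.
Qed.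

(** Induction on the number of columns already reduced: find a pivot, swap it into place, normalize
    it, clear the rest of its column. *)
Lemma row_equivalent_unit_columns (F : fieldType) (n : nat) (A : 'M[F]_n)
    (r : nat) :
    A \in unitmx -> (r <= n)%N ->
  exists2 B : 'M[F]_n, row_equivalent A B &
    forall i j : 'I_n, (j < r)%N -> B i j = (i == j)%:R.
Proof.
move=> unitA; elim: r => [|r IHr] r_n; first by exists A => //; apply: rt_refl.
have [B AB colB] := IHr (ltnW r_n).
pose k := Ordinal r_n.
have injB v : B *m v = 0 :> 'cV_n -> v = 0.
  by move=> /(row_equivalent_ker AB) Av0; rewrite -(mulKmx unitA v) Av0 mulmx0.
have [l kl Blk] := @pivot_exists _ _ B k injB colB.
pose C := xrow k l B.
pose D := scale_row k (B l k)^-1 C.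
exists (clear_rows k k (enum 'I_n) D).
  apply: rt_trans (row_equivalent_clear_rows _ _ _ _).
  apply: rt_trans AB _.
  apply: (@rt_trans _ _ _ C); last first.
    by apply: rt_step; apply: RowScale; rewrite invr_eq0.
  (* [RowSwap] demands distinct rows; a pivot already in place needs no operation. *)
  have [kl_eq|kl_neq] := eqVneq k l; last by apply: rt_step; apply: RowSwap.
  suff -> : C = B by apply: rt_refl.
  by apply/matrixP => i j; rewrite mxE -kl_eq tperm1 perm1.
(* Both swapped rows have index at least [r], so they are zero in the earlier columns. *)
have colC (i j : 'I_n) : (j < r)%N -> C i j = (i == j)%:R.
  move=> jr; rewrite mxE colB //; case: tpermP => [->|->|//].
    by rewrite -!val_eqE /= !gtn_eqF // (leq_trans jr).
  by rewrite -!val_eqE /= !gtn_eqF // (leq_trans jr).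
have Dkk : D k k = 1 by rewrite !mxE eqxx tpermL mulVf.
have colD (i j : 'I_n) : (j < r)%N -> D i j = (i == j)%:R.
  move=> jr; rewrite mxE !colC //; case: eqP => [->|//].
  by rewrite -val_eqE /= gtn_eqF // mulr0.
(* In column [r] the pivot 1 clears every other entry; in earlier columns row [k] is zero, so
   clearing changes nothing. *)
move=> i j; rewrite ltnS leq_eqVlt mxE mem_enum /= => /orP[/eqP jr|jr].
  have -> : j = k by apply: val_inj.
  by case: eqP => [->|_] /=; rewrite Dkk // mulr1 subrr.
have k_j : (k == j) = false by rewrite -val_eqE /= gtn_eqF.
by rewrite (colD i j) // (colD k j) // k_j mulr0 subr0 if_same.
Qed.

Lemma row_equivalent_unitmx (F : fieldType) (m n : nat) (P : 'M[F]_m)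
    (A : 'M[F]_(m, n)) :
  P \in unitmx -> row_equivalent (P *m A) A.
Proof.
move=> unitP.
have [B PB colB] := row_equivalent_unit_columns unitP (leqnn m).
have B1 : B = 1%:M by apply/matrixP => i j; rewrite colB // mxE.
by rewrite -{2}(mul1mx A) -B1; apply: row_equivalent_mulmxr.
Qed.

Lemma solutions_sub_augmented (F : fieldType) (p p' q : nat)
    (M : 'M[F]_(p, q)) (b : 'cV[F]_p) (M' : 'M[F]_(p', q)) (b' : 'cV[F]_p') :
    consistent M' b' ->
    (forall x, is_solution M' b' x -> is_solution M b x) ->
  (augmented M b <= augmented M' b')%MS.
Proof.
move=> [x0 M'x0] sol; have Mx0 := sol _ M'x0.
(* Kernel vectors are differences of solutions: compare [x0 + y] with [x0]. *)
have kerM (y : 'cV_q) : M' *m y = 0 -> M *m y = 0.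
  move=> M'y; have /sol : is_solution M' b' (x0 + y).
    by rewrite /is_solution mulmxDr M'y addr0.
  by rewrite /is_solution mulmxDr Mx0 => /(canRL (addKr _)); rewrite addNr.
have /submxP[X MX] : (M <= M')%MS.
  (* Row space inclusion means that [M] kills [cokermx M'], whose columns all lie in the kernel of
     [M']. *)
  rewrite submxE; apply/eqP/matrixP => i j.
  have /kerM/matrixP/(_ i 0) : M' *m col j (cokermx M') = 0.
    by rewrite !colE mulmxA mulmx_coker mul0mx.
  by rewrite colE mulmxA -colE !mxE.
(* The same [X] handles the last column: [b = M *m x0 = X *m M' *m x0 = X *m b']. *)
apply/submxP; exists X.
by rewrite /augmented mul_mx_row -MX -Mx0 -M'x0 mulmxA -MX.
Qed.

Theorem corollary2 (F : fieldType) (p q : nat) (M M' : 'M[F]_(p, q))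
    (b b' : 'cV[F]_p)
    (hM : consistent M b) (hM' : consistent M' b')
    (heq : solution_equivalent M b M' b') :
  row_equivalent (augmented M b) (augmented M' b').
Proof.
have : (augmented M b == augmented M' b')%MS.
  by apply/andP; split; apply: solutions_sub_augmented => // x /heq.
by case/eqmxMunitP => P unitP ->; apply: row_equivalent_unitmx.
Qed.
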